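(* Let $f=\max_k f_k:P^+\to\mathbb{R}_+$ be the control objective function of the stochastic power system described in the context, let $p_s\in P^+$, and let $v\in\mathbb{R}^{n^+-1}$ be such that $p_s+v\in P^+$. Write $I_{max}(p_s)=\{k\in\mathbb{Z}_{n_E}: f_k(p_s)=f(p_s)\}$. (a) If $I_{max}(p_s)=\{k\}$ and $A(k)p_s+b_k\ne0$, then the first directional derivative of $f$ at $p_s$ in the direction $v$ exists and $$f'(p_s,v)=f_k'(p_s,v)=\nabla f(p_s)\,v=\big(\nabla f_{as,k}(p_s)+r\nabla\sigma_k(p_s)\big)v,$$ which equals $$\Big[(1-(A(k)p_s+b_k)^2)^{-1/2}A(k)+r\nabla\sigma_k(p_s)\Big]v\quad\text{if }A(k)p_s+b_k>0,$$ $$\Big[-(1-(A(k)p_s+b_k)^2)^{-1/2}A(k)+r\nabla\sigma_k(p_s)\Big]v\quad\text{if }A(k)p_s+b_k<0.$$ (b) If $I_{max}(p_s)=\{k\}$ and $A(k)p_s+b_k=0$, then the first directional derivative of $f$ at $p_s$ in the direction $v$ exists and $$f'(p_s,v)=f_k'(p_s,v)=|A(k)v|+r\nabla\sigma_k(p_s)v.$$ (c) If $I_{max}(p_s)$ has two or more elements, then the first directional derivative of $f$ at $p_s$ in the direction $v$ exists and $$f'(p_s,v)=\max_{k\in I_{max}(p_s)}f_k'(p_s,v),$$ where $f_k'(p_s,v)$ is given by the expression in (a) or in (b) according to whether $A(k)p_s+b_k$ is nonzero or zero.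
   Context: The directional derivative is the one-sided limit $g'(x,v)=\lim_{t\downarrow0}\frac{g(x+tv)-g(x)}{t}$. Gradients are row vectors. Functions on $P^+$ are understood to be given by the same formulas on an open neighborhood of $P^+$, so gradients make sense at boundary points. $\mathbb{R}_+$ denotes the nonnegative reals, $\mathbb{Z}_n=\{1,\dots,n\}$, $A(k)$ is the $k$-th row of the matrix $A$, and $e_i$ is the $i$-th unit vector. Network data: a connected graph $G=(V,E)$ with $n_V$ vertices and $n_E$ edges and incidence matrix $B\in\mathbb{R}^{n_V\times n_E}$ (for the $k$-th edge $(i_k,j_k)$ the $k$-th column has $+1$ in row $i_k$, $-1$ in row $j_k$, zeros elsewhere); diagonal matrices $M\in\mathbb{R}^{n_V\times n_V}$ (strictly positive diagonal), $D\in\mathbb{R}^{n_V\times n_V}$ (nonnegative diagonal), $K_2\in\mathbb{R}^{n_V\times n_V}$ (nonnegative diagonal), $W\in\mathbb{R}^{n_E\times n_E}$ (strictly positive diagonal). Vertices $1,\dots,n^+$ ($n^+\ge 2$) are power supply nodes, vertices $n^++1,\dots,n_V$ are demand nodes. Given are $p^{+,max}\in\mathbb{R}_+^{n^+}$, $p^-\in\mathbb{R}_+^{n_V-n^+}$ with $p^-_{sum}=\sum_i p_i^->0$ and $\sum_{i=1}^{n^+}p_i^{+,max}\ge p^-_{sum}$, and a parameter $r>0$. Domain: $P^+=\{p_s\in\mathbb{R}_+^{n^+-1} : b_1\le A_1p_s,\ p_s\le b_2\}$ (componentwise), where $b_1(i)=p_{sum}^--p_{n^+}^{+,max}-\cdots-p_{i+1}^{+,max}$,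 $b_2(i)=p_i^{+,max}$, and $A_1\in\mathbb{R}^{(n^+-1)\times(n^+-1)}$ has $A_1(i,j)=1$ if $i\ge j$ and $0$ otherwise. Let $L=BWB^\top$ with Moore–Penrose inverse $L^\dagger$, $A=B^\top L^\dagger[e_1-e_{n^+},\dots,e_{n^+-1}-e_{n^+}]\in\mathbb{R}^{n_E\times(n^+-1)}$, $b=B^\top L^\dagger[e_{n^++1}-e_{n^+},\dots,e_{n_V}-e_{n^+}](-p^-)\in\mathbb{R}^{n_E}$. Standing assumption: $|A(k)p_s+b_k|<1$ for all $p_s\in P^+$, $k\in\mathbb{Z}_{n_E}$. Set $f_{as,k}(p_s)=\arcsin(|A(k)p_s+b_k|)$. Standard deviations: let $W(p_s)=W\,\mathrm{diag}(\cos(\arcsin(Ap_s+b)))$ and let $U(p_s)\in\mathbb{R}^{n_V\times n_V}$ be orthogonal such that $U(p_s)^\top M^{-1/2}BW(p_s)B^\top M^{-1/2}U(p_s)$ is diagonal with first diagonal entry $0$. For a matrix $X$ with $n_V$ columns let $X([2:n_V])$ be the matrix of its columns $2,\dots,n_V$. Put (writing $U=U(p_s)$) $$J_d(p_s)=\begin{bmatrix}0_{(n_V-1)\times(n_V-1)} & [\,0_{(n_V-1)\times1}\ \ I_{n_V-1}\,]\\ -(U^\top M^{-1/2}BW(p_s)B^\top M^{-1/2}U)([2:n_V]) & -U^\top M^{-1}DU\end{bmatrix},$$ $$K_d(p_s)=\begin{bmatrix}0_{(n_V-1)\times n_V}\\ U^\top M^{-1/2}K_2\end{bmatrix},\quad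 C_d(p_s)=[\,(B^\top M^{-1/2}U)([2:n_V])\ \ 0_{n_E\times n_V}\,].$$ Standing assumption: $J_d(p_s)$ is Hurwitz for all $p_s\in P^+$. Let $Q(p_s)$ be the unique solution of $J_dQ+QJ_d^\top+K_dK_d^\top=0$ and $\sigma_k(p_s)=\big((C_dQC_d^\top)(k,k)\big)^{1/2}$, assumed strictly positive on $P^+$. Control objective function: $f_k(p_s)=f_{as,k}(p_s)+r\,\sigma_k(p_s)$ and $f(p_s)=\max_{k\in\mathbb{Z}_{n_E}}f_k(p_s)$. *)

(* Defs.v *)
From HB Require Import structures.
From mathcomp Require Import all_boot all_order all_algebra.
From mathcomp Require Import complex.
From mathcomp Require Import all_classical all_reals all_analysis.

Set Implicit Arguments.
Unset Strict Implicit.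
Unset Printing Implicit Defensive.

Import Order.TTheory GRing.Theory Num.Theory.
Import numFieldNormedType.Exports.

Local Open Scope classical_set_scope.
Local Open Scope ring_scope.

Section Calculus.
Context {R : realType}.

Definition dirquot n (g : 'cV[R]_n -> R) (x v : 'cV[R]_n) : R -> R :=
  fun t => (g (x + t *: v) - g x) / t.

Definition dirderivable n (g : 'cV[R]_n -> R) (x v : 'cV[R]_n) : Prop :=
  cvg (dirquot g x v t @[t --> 0^'+]).

Definition dirderiv n (g : 'cV[R]_n -> R) (x v : 'cV[R]_n) : R :=
  lim (dirquot g x v t @[t --> 0^'+]).

Definition gradient n (g : 'cV[R]_n -> R) (x : 'cV[R]_n) : 'rV[R]_n :=
  \row_j 'D_(delta_mx j 0 : 'cV[R]_n) g x.

(* Maximum of F over a nonempty S (0 when S is empty).  Starting the iteration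
   at a value F k0 with k0 \in S keeps it correct when all values are negative. *)
Definition finmax (I : finType) (S : {set I}) (F : I -> R) : R :=
  if [pick k in S] is Some k0 then \big[Num.max/F k0]_(k in S) F k else 0.

Definition moore_penrose m n (X : 'M[R]_(m, n)) : 'M[R]_(n, m) :=
  get [set Y : 'M[R]_(n, m) | [/\ X *m Y *m X = X, Y *m X *m Y = Y,
                                  (X *m Y)^T = X *m Y & (Y *m X)^T = Y *m X]].

Definition inv_sqrt_diag n (X : 'M[R]_n) : 'M[R]_n :=
  diag_mx (\row_i (Num.sqrt (X i i))^-1).

(* The columns 2, ..., n+1 of X. *)
Definition tail_cols m n (X : 'M[R]_(m, n.+1)) : 'M[R]_(m, n) := col' ord0 X.

Definition hurwitz n (X : 'M[R]_n) : Prop :=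
  forall z : complex R,
    eigenvalue (map_mx (real_complex R) X) z -> complex.Re z < 0.

End Calculus.

Definition adjacent (V E : finType) (ends : E -> V * V) : rel V :=
  [rel i j | [exists k, (ends k == (i, j)) || (ends k == (j, i))]].

(* Indices are 0-based: n^+ = ns.+1, the supply vertices are 0, ..., ns, the
   demand vertices are ns.+1, ..., ns + nd, and n_V = (ns + nd).+1, which is
   convertible to ns.+1 + nd.  inertia, damping, noise, weight and risk are
   M, D, K_2, W and r. *)
Record network (R : realType) := Network {
  ns : nat;
  nd : nat;
  nE : nat;
  nsupply_ge2 : (2 <= ns.+1)%N;
  edge : 'I_nE -> 'I_(ns + nd).+1 * 'I_(ns + nd).+1;
  edge_loopless : forall k, (edge k).1 != (edge k).2;
  edge_simple : injective (fun k => [set (edge k).1; (edge k).2]%SET);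
  edge_connected : forall i j, connect (adjacent edge) i j;
  inertia : 'M[R]_((ns + nd).+1);
  damping : 'M[R]_((ns + nd).+1);
  noise : 'M[R]_((ns + nd).+1);
  weight : 'M[R]_nE;
  inertia_diag : is_diag_mx inertia;
  damping_diag : is_diag_mx damping;
  noise_diag : is_diag_mx noise;
  weight_diag : is_diag_mx weight;
  inertia_gt0 : forall i, 0 < inertia i i;
  damping_ge0 : forall i, 0 <= damping i i;
  noise_ge0 : forall i, 0 <= noise i i;
  weight_gt0 : forall k, 0 < weight k k;
  pmax : 'cV[R]_ns.+1;
  pminus : 'cV[R]_nd;
  risk : R;
  pmax_ge0 : forall i, 0 <= pmax i 0;
  pminus_ge0 : forall i, 0 <= pminus i 0;
  pminus_sum_gt0 : 0 < \sum_i pminus i 0;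
  supply_ge_demand : \sum_i pminus i 0 <= \sum_i pmax i 0;
  risk_gt0 : 0 < risk
}.

Arguments edge {R} n k.

Section Network.
Context {R : realType} (N : network R).

Local Notation s := (ns N).
Local Notation d := (nd N).
Local Notation m := (nE N).
Local Notation nV := (ns N + nd N).+1.
Local Notation M := (inertia N).
Local Notation D := (damping N).
Local Notation K2 := (noise N).
Local Notation W := (weight N).

Definition A1 : 'M[R]_s := \matrix_(i, j) (j <= i)%:R.

Definition b1 : 'cV[R]_s :=
  \col_i (\sum_j pminus N j 0 - \sum_(j < s.+1 | (i < j)%N) pmax N j 0).

Definition b2 : 'cV[R]_s := \col_i pmax N (widen_ord (leqnSn s) i) 0.

Definition Pplus : set 'cV[R]_s :=
  [set p : 'cV[R]_s | forall i : 'I_s,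
     [/\ 0 <= p i 0, b1 i 0 <= (A1 *m p) i 0 & p i 0 <= b2 i 0]].

Definition incidence : 'M[R]_(nV, m) :=
  \matrix_(i, k) ((i == (edge N k).1)%:R - (i == (edge N k).2)%:R).
Local Notation B := incidence.

Definition laplacian : 'M[R]_nV := B *m W *m B^T.

(* The columns e_j - e_{n^+} for the supply vertices j < n^+, resp. for the
   demand vertices j. *)
Definition supply_diff : 'M[R]_(nV, s) :=
  \matrix_(i, j) ((i == j :> nat)%:R - (i == s :> nat)%:R).

Definition demand_diff : 'M[R]_(nV, d) :=
  \matrix_(i, j) ((i == (s.+1 + j)%N :> nat)%:R - (i == s :> nat)%:R).

Definition flowA : 'M[R]_(m, s) :=
  B^T *m moore_penrose laplacian *m supply_diff.

Definition flowb : 'cV[R]_m :=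
  B^T *m moore_penrose laplacian *m demand_diff *m (- pminus N).

(* A(k) p + b_k *)
Definition flow (k : 'I_m) (p : 'cV[R]_s) : R := (flowA *m p + flowb) k 0.

Definition f_as (k : 'I_m) (p : 'cV[R]_s) : R := asin `|flow k p|.

Definition Wp (p : 'cV[R]_s) : 'M[R]_m :=
  W *m diag_mx (\row_k cos (asin (flow k p))).

Definition modal (p : 'cV[R]_s) (U : 'M[R]_nV) : 'M[R]_nV :=
  U^T *m inv_sqrt_diag M *m B *m Wp p *m B^T *m inv_sqrt_diag M *m U.

Definition modal_frame (p : 'cV[R]_s) (U : 'M[R]_nV) : Prop :=
  [/\ U^T *m U = 1%:M, is_diag_mx (modal p U) & modal p U ord0 ord0 = 0].

Definition Jd (p : 'cV[R]_s) (U : 'M[R]_nV) : 'M[R]_((s + d) + nV) :=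
  block_mx 0 (row_mx (0 : 'M[R]_(s + d, 1)) 1%:M)
           (- tail_cols (modal p U)) (- (U^T *m invmx M *m D *m U)).

Definition Kd (U : 'M[R]_nV) : 'M[R]_((s + d) + nV, nV) :=
  col_mx 0 (U^T *m inv_sqrt_diag M *m K2).

Definition Cd (U : 'M[R]_nV) : 'M[R]_(m, (s + d) + nV) :=
  row_mx (tail_cols (B^T *m inv_sqrt_diag M *m U)) 0.

(* The unique solution when Jd p U is Hurwitz. *)
Definition Qd (p : 'cV[R]_s) (U : 'M[R]_nV) : 'M[R]_((s + d) + nV) :=
  get [set Q | Jd p U *m Q + Q *m (Jd p U)^T + Kd U *m (Kd U)^T = 0].

(* U selects a modal frame at each point.  All functions below are total, hence
   given by the same formulas off P^+. *)
Section Frame.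
Variable U : 'cV[R]_s -> 'M[R]_nV.

Definition sigma (k : 'I_m) (p : 'cV[R]_s) : R :=
  Num.sqrt ((Cd (U p) *m Qd p (U p) *m (Cd (U p))^T) k k).

Definition f_line (k : 'I_m) (p : 'cV[R]_s) : R :=
  f_as k p + risk N * sigma k p.

Definition f_obj (p : 'cV[R]_s) : R :=
  finmax [set: 'I_m]%SET (fun k => f_line k p).

Definition Imax (p : 'cV[R]_s) : {set 'I_m} :=
  [set k | f_line k p == f_obj p]%SET.

End Frame.
End Network.

Arguments Pplus {R} N.

(* Main.v *)
(* The frames U(p) may be chosen discontinuously, but sigma_k does not see the
   choice.  As the graph is connected and W(p) is positive near P^+, the first
   column of every frame spans the fixed line of M^{1/2} 1, so two frames U and V
   differ by an orthogonal map preserving the span of the remaining columns;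
   the corresponding orthogonal change of state variables turns J_d, K_d, C_d for
   U into those for V and leaves C_d Q C_d^T unchanged.  Near a point p one may
   therefore use the constant frame V = U(p).  The Lyapunov operator
   Q |-> J Q + Q J^T is invertible at p by the Hurwitz property, hence also near
   p, and by Cramer's rule its inverse has differentiable entries; so sigma_k is
   differentiable at p.  Along a ray, |A(k) p + b_k| is eventually affine, which
   gives the one-sided derivative of the arcsin term.  Finally, f is near p the
   maximum over I_max(p) only, and the difference quotient of this maximum is the
   maximum of the difference quotients. *)
Require Import Defs.
From HB Require Import structures.
From mathcomp Require Import all_boot all_order all_algebra.
From mathcomp Require Import complex.
From mathcomp Require Import all_classical all_reals all_analysis.

Set Implicit Arguments.
Unset Strict Implicit.
Unset Printing Implicit Defensive.

Import Order.TTheory GRing.Theory Num.Theory.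
Import numFieldNormedType.Exports.

Local Open Scope classical_set_scope.
Local Open Scope ring_scope.

(** * Sylvester and Lyapunov equations *)

Lemma horner_mx_intertwine (F : comNzRingType) m n (A : 'M[F]_m.+1)
    (B : 'M[F]_n.+1) (X : 'M[F]_(m.+1, n.+1)) (p : {poly F}) :
  A *m X = X *m B -> horner_mx A p *m X = X *m horner_mx B p.
Proof.
move=> AX; elim/poly_ind: p => [|p c IH]; first by rewrite !rmorph0 mul0mx mulmx0.
rewrite !rmorphD !rmorphM /= !horner_mx_X !horner_mx_C mulmxDl mulmxDr.
by rewrite -mulmxA AX !mulmxA IH mul_scalar_mx mul_mx_scalar.
Qed.

(* If p is the characteristic polynomial of A, then 0 = p(A) X = X p(B), and p(B)
   is invertible when no root of p is an eigenvalue of B. *)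
Lemma sylvester_eq0 (F : closedFieldType) m n (A : 'M[F]_m) (B : 'M[F]_n)
    (X : 'M[F]_(m, n)) :
  A *m X = X *m B -> (forall a, eigenvalue A a -> ~~ eigenvalue B a) -> X = 0.
Proof.
(* Polynomials of a matrix require a nonzero dimension; with no rows or no columns [X] is trivially
   zero. *)
case: m A X => [|m] A X; first by move=> *; apply/matrixP => -[].
case: n B X => [|n] B X AX AB; first by apply/matrixP => i [].
have := horner_mx_intertwine (char_poly A) AX.
rewrite Cayley_Hamilton mul0mx => /esym XB.
suff Bu : horner_mx B (char_poly A) \in unitmx.
  by rewrite -[X](mulmxK Bu) XB mul0mx.
have [r rE] := closed_field_poly_normal (char_poly A).
have rA z : z \in r -> eigenvalue A z.
  move=> zr; rewrite eigenvalue_root_char rE rootE hornerZ.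
  by rewrite (_ : _.[z] = 0) ?mulr0 //; apply/rootP; rewrite root_prod_XsubC.
rewrite rE (eqP (char_poly_monic A)) scale1r rmorph_prod /=.
(* [char_poly A] is monic and splits, so [p(B)] is a product of factors [B - z] with [z] an
   eigenvalue of [A]. Since [z] is then no eigenvalue of [B], each factor is invertible. *)
rewrite big_seq; elim/big_rec: _ => [|z M zr IH]; first exact: unitmx1.
rewrite rmorphB /= horner_mx_X horner_mx_C unitmx_mul IH andbT.
have /AB := rA z zr; apply: contraR.
by rewrite /eigenvalue kermx_eq0 row_free_unit.
Qed.

Lemma eigenvalue_oppr (F : fieldType) n (A : 'M[F]_n) a :
  eigenvalue (- A) a -> eigenvalue A (- a).
Proof.
move=> /eigenvalueP[v vA v0]; apply/eigenvalueP; exists v => //.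
by rewrite -[A]opprK mulmxN vA scaleNr.
Qed.

Lemma eigenvalue_tr (F : fieldType) n (A : 'M[F]_n) a :
  eigenvalue A^T a = eigenvalue A a.
Proof.
rewrite /eigenvalue !kermx_eq0 !row_free_unit -unitmx_tr linearB /=.
by rewrite tr_scalar_mx trmxK.
Qed.

Section Lyapunov.
Context {R : realType} {n : nat}.
Implicit Types J S Q : 'M[R]_n.

(** The operator [Q |-> J Q + Q J^T] as a matrix acting on the right of [mxvec Q], so that
    determinants and Cramer's rule apply to it. *)
Definition lyapunov_mx J := lin_mulmx J + lin_mulmxr J^T : 'M[R]_(n * n).

Definition lyapunov_sol J S : 'M[R]_n :=
  vec_mx (- mxvec S *m invmx (lyapunov_mx J)).

Lemma mul_lyapunov_mx J Q :
  mxvec Q *m lyapunov_mx J = mxvec (J *m Q + Q *m J^T).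
Proof. by rewrite mulmxDr !mul_vec_lin linearD. Qed.

(** A kernel element satisfies [J Q = Q (- J^T)]. Over the complex numbers the eigenvalues of [J]
    have negative real part and those of [- J^T] positive real part, so the spectra are disjoint and
    the Sylvester argument gives [Q = 0]. *)
Lemma hurwitz_lyapunov_unit J : hurwitz J -> lyapunov_mx J \in unitmx.
Proof.
move=> HJ; rewrite -row_free_unit; apply: inj_row_free => v.
rewrite -[v]vec_mxK; move: (vec_mx v) => Q.
rewrite mul_lyapunov_mx => /(congr1 vec_mx)/eqP.
rewrite mxvecK linear0 addr_eq0 => /eqP JQ.
suff -> : Q = 0 by rewrite linear0.
pose f := map_mx (real_complex R).
suff : f n n Q = 0 by move=> /eqP; rewrite map_mx_eq0 => /eqP.
apply: (@sylvester_eq0 _ _ _ (f _ _ J) (- (f _ _ J)^T)).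
  by rewrite mulmxN /f map_trmx -!map_mxM /= JQ map_mxN.
move=> a /HJ aJ; apply/negP => /eigenvalue_oppr; rewrite eigenvalue_tr => /HJ.
by case: a aJ => x y /= x0; rewrite oppr_lt0 ltNge ltW.
Qed.

Lemma lyapunov_solP J S Q : lyapunov_mx J \in unitmx ->
  J *m Q + Q *m J^T + S = 0 <-> Q = lyapunov_sol J S.
Proof.
move=> uJ; split=> [/eqP|->]; last first.
  apply: (can_inj mxvecK); rewrite linearD /= -mul_lyapunov_mx /lyapunov_sol.
  by rewrite vec_mxK mulmxKV // addNr linear0.
rewrite addr_eq0 => /eqP /(congr1 mxvec); rewrite -mul_lyapunov_mx => QE.
by rewrite /lyapunov_sol -linearN /= -QE mulmxK // mxvecK.
Qed.

Lemma lyapunov_conj J S Q (T : 'M[R]_n) : T^T *m T = 1%:M ->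
  (T^T *m J *m T) *m (T^T *m Q *m T) + (T^T *m Q *m T) *m (T^T *m J *m T)^T
    + T^T *m S *m T = T^T *m (J *m Q + Q *m J^T + S) *m T.
Proof.
move=> /mulmx1C TT.
have conjM X Y : T^T *m X *m T *m (T^T *m Y *m T) = T^T *m (X *m Y) *m T.
  by rewrite !mulmxA -[_ *m T *m T^T]mulmxA TT mulmx1.
have -> : (T^T *m J *m T)^T = T^T *m J^T *m T by rewrite !trmx_mul trmxK mulmxA.
by rewrite !conjM !mulmxDr !mulmxDl.
Qed.

End Lyapunov.

(** * Independence of sigma from the frame *)

Section TailCols.
Context {R : realType}.

Lemma tail_colsM l m n (A : 'M[R]_(l, m)) (X : 'M[R]_(m, n.+1)) :
  tail_cols (A *m X) = A *m tail_cols X.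
Proof. by apply/matrixP=> i j; rewrite !mxE; apply: eq_bigr => k _; rewrite !mxE. Qed.

(** This writes the block [[0 I]] of [Jd] as a product involving the frame, which makes its
    behaviour under a change of frame computable. *)
Lemma tail_cols_tr_mul n (U : 'M[R]_n.+1) : U^T *m U = 1%:M ->
  (tail_cols U)^T *m U = row_mx (0 : 'M[R]_(n, 1)) 1%:M.
Proof.
move=> UU; apply/matrixP => i j.
transitivity ((U^T *m U) (lift ord0 i) j).
  by rewrite !mxE; apply: eq_bigr => k _; rewrite !mxE.
rewrite UU [LHS]mxE [RHS]mxE -val_eqE /=; case: splitP => k jk.
  by rewrite mxE jk (ord1 k).
by rewrite mxE -val_eqE /= jk /bump /= add1n eqSS.
Qed.

Lemma tail_cols_tr_tail n (U : 'M[R]_n.+1) : U^T *m U = 1%:M ->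
  (tail_cols U)^T *m tail_cols U = 1%:M.
Proof.
move=> UU; rewrite -tail_colsM tail_cols_tr_mul //; apply/matrixP => i j.
rewrite mxE -[RHS](row_mxEr (0 : 'M[R]_(n, 1)) 1%:M i j).
by congr (row_mx _ _ _ _); apply: val_inj.
Qed.

Variables (n : nat) (U V : 'M[R]_n.+1) (a : 'I_n.+1 -> R) (c c' : R).
Hypotheses (UU : U^T *m U = 1%:M) (VV : V^T *m V = 1%:M).
Hypotheses (U0 : forall i, U i ord0 = c * a i) (V0 : forall i, V i ord0 = c' * a i).

(** The first column of [V] is proportional to that of [U], hence orthogonal to the other columns of
    [U]. Expanding those columns in the orthonormal basis [V] therefore involves only the tail of
    [V]. *)
Lemma tail_cols_transition :
  tail_cols U = tail_cols V *m ((tail_cols V)^T *m tail_cols U).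
Proof.
(* The first column of an orthogonal matrix is a unit vector, so it cannot vanish. *)
have c0 : c != 0.
  apply: contra_neq (oner_neq0 R) => c0.
  have := congr1 (fun X : 'M[R]_n.+1 => X ord0 ord0) UU; rewrite !mxE /= mulr1n => <-.
  by rewrite big1 // => i _; rewrite !mxE U0 c0 !mul0r.
have VU0 j : (V^T *m U) ord0 (lift ord0 j) = 0.
  have UUj : (U^T *m U) ord0 (lift ord0 j) = 0 by rewrite UU mxE.
  rewrite -(mulr0 (c' / c)) -[X in _ * X]UUj !mxE mulr_sumr.
  by apply: eq_bigr => i _; rewrite !mxE U0 V0 !mulrA divfK.
have {1}-> : U = V *m (V^T *m U) by rewrite mulmxA (mulmx1C VV) mul1mx.
rewrite tail_colsM; apply/matrixP => i j; rewrite !mxE big_ord_recl.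
rewrite [X in _ * X]mxE VU0 mulr0 add0r; apply: eq_bigr => k _.
by rewrite !mxE; congr (_ * _); apply: eq_bigr => l _; rewrite !mxE.
Qed.

End TailCols.

Section FrameInvariance.
Context {R : realType} (N : network R).
Local Notation s := (ns N).
Local Notation d := (nd N).
Local Notation m := (nE N).
Local Notation nV := (ns N + nd N).+1.
Local Notation B := (incidence N).
Local Notation isd := (inv_sqrt_diag (inertia N)).
Implicit Types (p : 'cV[R]_s) (U V : 'M[R]_nV).

Lemma Wp_diag p :
  Wp p = diag_mx (\row_k (weight N k k * cos (asin (flow k p)))).
Proof.
have /is_diag_mxP W := weight_diag N.
apply/matrixP => i j; rewrite /Wp mul_mx_diag !mxE.
have [->|ij] := eqVneq i j; first by rewrite mulr1n.
by rewrite W // mul0r mulr0n.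
Qed.

Lemma cos_asin_gt0 (x : R) : `|x| < 1 -> 0 < cos (asin x).
Proof.
rewrite ltr_norml => /andP[x1 x2]; rewrite cos_asin ?(ltW x1) ?(ltW x2) //.
by rewrite sqrtr_gt0 subr_gt0 -(real_normK (num_real x)) expr_lt1 // ltr_norml x1.
Qed.

Lemma tr_incidence_mul n (Y : 'M[R]_(nV, n)) k j :
  (B^T *m Y) k j = Y (edge N k).1 j - Y (edge N k).2 j.
Proof.
rewrite mxE (eq_bigr (fun i => (i == (edge N k).1)%:R * Y i j
   - (i == (edge N k).2)%:R * Y i j)); last first.
  by move=> i _; rewrite !mxE mulrBl.
rewrite sumrB (bigD1 (edge N k).1) //= eqxx mul1r big1; last first.
  by move=> i /negbTE ->; rewrite mul0r.
rewrite addr0 (bigD1 (edge N k).2) //= eqxx mul1r big1 ?addr0 //.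
by move=> i /negbTE ->; rewrite mul0r.
Qed.

(* The kernel of M^{-1/2} B W(p) B^T M^{-1/2} is spanned by M^{1/2} 1, because
   the graph is connected and W(p) is positive. *)
Lemma modal_frame_col0 p U : (forall k, `|flow k p| < 1) -> modal_frame p U ->
  exists c, forall i, U i ord0 = c * Num.sqrt (inertia N i i).
Proof.
move=> fl [_ _ U00].
pose X := isd *m U.
have XE i j : X i j = (Num.sqrt (inertia N i i))^-1 * U i j.
  by rewrite /X /isd mul_diag_mx !mxE.
have BX k : (B^T *m X) k ord0 = 0.
  (* The vanishing first diagonal entry of [modal p U] is the quadratic form of [Wp p] at the first
     column of [B^T X]: a sum of squares with positive weights, so every square is zero. *)
  have : \sum_k (weight N k k * cos (asin (flow k p)))
            * ((B^T *m X) k ord0) ^+ 2 = 0.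
    rewrite -[RHS]U00 /modal.
    rewrite (_ : _ *m U = (B^T *m X)^T *m Wp p *m (B^T *m X)); last first.
      by rewrite /X /inv_sqrt_diag !trmx_mul trmxK tr_diag_mx !mulmxA.
    move: (B^T *m X) => Z.
    rewrite Wp_diag mul_mx_diag [RHS]mxE; apply: eq_bigr => l _.
    by rewrite !mxE expr2 mulrA [in RHS](mulrC (Z _ _)).
  have w_gt0 l : 0 < weight N l l * cos (asin (flow l p)).
    by rewrite mulr_gt0 ?weight_gt0 ?cos_asin_gt0.
  move=> /psumr_eq0P W0.
  have /eqP := W0 (fun l _ => mulr_ge0 (ltW (w_gt0 l)) (sqr_ge0 _)) k isT.
  by rewrite mulf_eq0 gt_eqF //= sqrf_eq0 => /eqP.
have Xedge k : X (edge N k).1 ord0 = X (edge N k).2 ord0.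
  by apply/eqP; rewrite -subr_eq0 -tr_incidence_mul BX.
have Xpath w i : path (Defs.adjacent (edge N)) i w -> X (last i w) ord0 = X i ord0.
  elim: w i => //= j w IH i /andP[/existsP[k ijk] /IH ->].
  by have := Xedge k; case/orP: ijk => /eqP ->.
have Xconst i : X i ord0 = X ord0 ord0.
  have /connectP[w wP w0] := edge_connected ord0 i.
  by rewrite w0 Xpath.
(* The first column of [X = M^{-1/2} U] is constant along edges, hence along paths; [c] is its
   common value. *)
exists (X ord0 ord0) => i.
by rewrite -(Xconst i) XE mulrAC mulVf ?mul1r // sqrtr_eq0 -ltNge inertia_gt0.
Qed.

(** The state splits into the modal angles without the first one and all modal frequencies. The
    change of frame acts on the former by [Y] and on the latter by [V^T U]; in each block the factor
    [V V^T = 1] cancels. *)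
Lemma Jd_transition p U V (Y := (tail_cols V)^T *m tail_cols U)
    (T := block_mx Y 0 0 (V^T *m U)) :
  U^T *m U = 1%:M -> V^T *m V = 1%:M -> tail_cols U = tail_cols V *m Y ->
  [/\ T^T *m T = 1%:M, Jd p U = T^T *m Jd p V *m T,
      Kd U = T^T *m Kd V & Cd U = Cd V *m T].
Proof.
move=> UU VV UVY.
have VV' := mulmx1C VV.
have TT : T^T = block_mx Y^T 0 0 (U^T *m V).
  by rewrite /T tr_block_mx !trmx0 [(V^T *m U)^T]trmx_mul trmxK.
have VU n (X : 'M[R]_(nV, n)) : U^T *m V *m (V^T *m X) = U^T *m X.
  by rewrite mulmxA -[X in X *m _]mulmxA VV' mulmx1.
have YU : Y^T *m (tail_cols V)^T = (tail_cols U)^T by rewrite -trmx_mul -UVY.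
have tU : (tail_cols U)^T *m tail_cols U = 1%:M.
  exact: tail_cols_tr_tail.
have RT : V *m (V^T *m U) = U by rewrite mulmxA VV' mul1mx.
have mT : tail_cols (modal p U) = U^T *m V *m tail_cols (modal p V) *m Y.
  rewrite /modal !tail_colsM UVY -!mulmxA; congr (U^T *m _).
  by rewrite [V *m (V^T *m _)]mulmxA VV' mul1mx.
split.
- rewrite TT mulmx_block !mulmx0 !mul0mx !addr0 !add0r VU UU.
  by rewrite {2}/Y mulmxA YU tU -scalar_mx_block.
- rewrite TT /Jd !mulmx_block !mulmx0 !mul0mx !addr0 !add0r.
  rewrite mT.
  congr block_mx.
  + by rewrite mul0mx.
  + have PV := tail_cols_tr_mul VV; have PU := tail_cols_tr_mul UU.
    by rewrite -[LHS]PU -PV -!mulmxA RT mulmxA YU.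
  + by rewrite mulmxN mulNmx.
  + rewrite mulmxN mulNmx; congr (- _); rewrite -!mulmxA RT.
    by rewrite [V *m (V^T *m _)]mulmxA VV' mul1mx.
- rewrite TT /Kd mul_block_col !mulmx0 !mul0mx !addr0 !add0r.
  by rewrite -!mulmxA [V *m (V^T *m _)]mulmxA VV' mul1mx.
- rewrite /Cd mul_row_block !mulmx0 !mul0mx !addr0.
  by rewrite !tail_colsM -!mulmxA -UVY.
Qed.
(** [V] is any orthogonal matrix with the prescribed first column, so a frame frozen at one point
    serves at all nearby points. Conjugation by the transition matrix [T] matches the two Lyapunov
    equations, and [T] cancels in the output covariance. *)
Lemma sigma_fixed_frame (U : 'cV[R]_s -> 'M[R]_nV) V (c : R) p k :
  (forall l, `|flow l p| < 1) -> modal_frame p (U p) ->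
  V^T *m V = 1%:M -> (forall i, V i ord0 = c * Num.sqrt (inertia N i i)) ->
  lyapunov_mx (Jd p V) \in unitmx ->
  sigma U k p = Num.sqrt
    ((Cd V *m lyapunov_sol (Jd p V) (Kd V *m (Kd V)^T) *m (Cd V)^T) k k).
Proof.
move=> fl Uf VV V0 uJ; have [UU _ _] := Uf.
have [c' U0] := modal_frame_col0 fl Uf.
have [] := Jd_transition p UU VV (tail_cols_transition UU VV U0 V0).
set T := block_mx _ _ _ _ => TT JU KU CU.
have TT' := mulmx1C TT.
have lyapE Q : Jd p (U p) *m Q + Q *m (Jd p (U p))^T + Kd (U p) *m (Kd (U p))^T = 0
    <-> T *m Q *m T^T = lyapunov_sol (Jd p V) (Kd V *m (Kd V)^T).
  rewrite -lyapunov_solP //.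
  have {1 2}-> : Q = T^T *m (T *m Q *m T^T) *m T.
    by rewrite !mulmxA TT mul1mx -mulmxA TT mulmx1.
  rewrite JU KU [(T^T *m Kd V)^T]trmx_mul trmxK.
  rewrite (_ : _ *m Kd V *m _ = T^T *m (Kd V *m (Kd V)^T) *m T); last first.
    by rewrite !mulmxA.
  rewrite lyapunov_conj //; split=> [H|->]; last by rewrite mulmx0 mul0mx.
  move: H => /(congr1 (fun X => T *m X *m T^T)).
  by rewrite mulmx0 mul0mx !mulmxA TT' mul1mx -mulmxA TT' mulmx1.
(* [Qd] is obtained by choice, so a solution has to be exhibited: the one for [V], pulled back by
   [T]. *)
have QE : T *m Qd p (U p) *m T^T = lyapunov_sol (Jd p V) (Kd V *m (Kd V)^T).
  apply/lyapE; suff /getPex : exists Q, [set Q | Jd p (U p) *m Q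
    + Q *m (Jd p (U p))^T + Kd (U p) *m (Kd (U p))^T = 0] Q by [].
  exists (T^T *m lyapunov_sol (Jd p V) (Kd V *m (Kd V)^T) *m T).
  by apply/lyapE; rewrite !mulmxA TT' mul1mx -mulmxA TT' mulmx1.
by rewrite /sigma -QE CU trmx_mul !mulmxA.
Qed.

End FrameInvariance.

(** * Differentiability of matrix expressions *)

Section EntrywiseDifferentiability.
Context {R : realType} {V : normedModType R}.
Variable x : V.

(** The differential of [g] also gives the first-order expansion of [f] at [x]; uniqueness
    identifies it with the differential of [f]. *)
Lemma near_eq_differentiable (W : normedModType R) (f g : V -> W) :
  (\forall y \near x, f y = g y) -> differentiable g x -> differentiable f x.
Proof.
move=> fg dg; have [dgc /eqaddoP gE] := (diff_locallyP _ _).1 dg.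
have fE : f \o shift x = cst (f x) + 'd g x +o_ 0 id.
  have fx := nbhs_singleton fg.
  move: fg; rewrite (near_shift 0 x) subr0 => fg.
  apply/eqaddoP => e /gE; apply: filterS2 fg => y /= fgy.
  by rewrite !fctE /= fgy fx.
have dE := diff_unique dgc fE.
by apply/diff_locallyP; rewrite dE.
Qed.

Lemma differentiable_bigsum (I : Type) (r : seq I) (P : pred I) (f : I -> V -> R) :
  (forall i, P i -> differentiable (f i) x) ->
  differentiable (fun y => \sum_(i <- r | P i) f i y) x.
Proof.
move=> df; elim: r => [|i r IH].
  by under eq_fun do rewrite big_nil; exact: differentiable_cst.
under eq_fun do rewrite big_cons.
case: (boolP (P i)) => // Pi.
by apply: differentiableD => //; exact: df.
Qed.

Lemma differentiable_bigprod (I : Type) (r : seq I) (P : pred I) (f : I -> V -> R) :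
  (forall i, P i -> differentiable (f i) x) ->
  differentiable (fun y => \prod_(i <- r | P i) f i y) x.
Proof.
move=> df; elim: r => [|i r IH].
  by under eq_fun do rewrite big_nil; exact: differentiable_cst.
under eq_fun do rewrite big_cons.
case: (boolP (P i)) => // Pi.
by apply: differentiableM => //; exact: df.
Qed.

Lemma differentiable_comp_derive (f : R -> R) (g : V -> R) l :
  is_derive (g x) 1 f l -> differentiable g x -> differentiable (f \o g) x.
Proof.
move=> [df _] dg; apply: differentiable_comp => //.
exact/derivable1_diffP.
Qed.

Definition mxdiff m n (F : V -> 'M[R]_(m, n)) :=
  forall i j, differentiable (fun y => F y i j) x.

Lemma mxdiff_cst m n (A : 'M[R]_(m, n)) : mxdiff (fun=> A).
Proof. by move=> i j; exact: differentiable_cst. Qed.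

Lemma mxdiffD m n (F G : V -> 'M[R]_(m, n)) :
  mxdiff F -> mxdiff G -> mxdiff (fun y => F y + G y).
Proof.
move=> dF dG i j; under eq_fun do rewrite mxE.
exact: differentiableD.
Qed.

Lemma mxdiffN m n (F : V -> 'M[R]_(m, n)) : mxdiff F -> mxdiff (fun y => - F y).
Proof.
move=> dF i j; under eq_fun do rewrite mxE.
exact: differentiableN.
Qed.

Lemma mxdiffM l m n (F : V -> 'M[R]_(l, m)) (G : V -> 'M[R]_(m, n)) :
  mxdiff F -> mxdiff G -> mxdiff (fun y => F y *m G y).
Proof.
move=> dF dG i j; under eq_fun do rewrite mxE.
by apply: differentiable_bigsum => k _; exact: differentiableM.
Qed.

Lemma mxdiff_tr m n (F : V -> 'M[R]_(m, n)) : mxdiff F -> mxdiff (fun y => (F y)^T).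
Proof. by move=> dF i j; under eq_fun do rewrite mxE; exact: dF. Qed.

Lemma mxdiff_row_mx m n1 n2 (F : V -> 'M[R]_(m, n1)) (G : V -> 'M[R]_(m, n2)) :
  mxdiff F -> mxdiff G -> mxdiff (fun y => row_mx (F y) (G y)).
Proof.
move=> dF dG i j; under eq_fun do rewrite mxE.
by case: fintype.split => k; [exact: dF|exact: dG].
Qed.

Lemma mxdiff_col_mx m1 m2 n (F : V -> 'M[R]_(m1, n)) (G : V -> 'M[R]_(m2, n)) :
  mxdiff F -> mxdiff G -> mxdiff (fun y => col_mx (F y) (G y)).
Proof.
move=> dF dG i j; under eq_fun do rewrite mxE.
by case: fintype.split => k; [exact: dF|exact: dG].
Qed.

Lemma differentiable_det n (F : V -> 'M[R]_n) :
  mxdiff F -> differentiable (fun y => \det (F y)) x.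
Proof.
move=> dF; apply: differentiable_bigsum => s _; apply: differentiableM.
  exact: differentiable_cst.
by apply: differentiable_bigprod => i _; exact: dF.
Qed.

Lemma mxdiff_adj n (F : V -> 'M[R]_n) : mxdiff F -> mxdiff (fun y => \adj (F y)).
Proof.
move=> dF i j; under eq_fun do rewrite mxE.
apply: differentiableM; first exact: differentiable_cst.
by apply: differentiable_det => k l; under eq_fun do rewrite !mxE; exact: dF.
Qed.

Lemma near_unitmx n (F : V -> 'M[R]_n) : mxdiff F -> F x \in unitmx ->
  \forall y \near x, F y \in unitmx.
Proof.
move=> /differentiable_det/differentiable_continuous dF.
rewrite unitmxE unitfE => Fx; near=> y; rewrite unitmxE unitfE.
by near: y; apply: cvgr_neq0 Fx; exact: dF.
Unshelve. all: by end_near. Qed.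

(** Cramer's rule: [invmx] is adjugate over determinant wherever the matrix is invertible, which
    holds throughout a neighborhood of [x]. *)
Lemma mxdiff_inv n (F : V -> 'M[R]_n) : mxdiff F -> F x \in unitmx ->
  mxdiff (fun y => invmx (F y)).
Proof.
move=> dF uF i j.
apply: (@near_eq_differentiable _ _ (fun y => (\det (F y))^-1 * \adj (F y) i j)).
  near=> y; rewrite /invmx ifT ?mxE //.
  by near: y; exact: near_unitmx.
apply: differentiableM; last exact: mxdiff_adj.
apply: differentiableV; first exact: differentiable_det.
by rewrite -unitfE -unitmxE.
Unshelve. all: by end_near. Qed.

Lemma mxdiff_lyapunov_mx n (F : V -> 'M[R]_n) :
  mxdiff F -> mxdiff (fun y => lyapunov_mx (F y)).
Proof.
(* Rows and columns are indexed by pairs; a row of the matrix of a linear map is its value at an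
   elementary matrix, here a product of [F y] or its transpose with a constant. *)
move=> dF; apply: mxdiffD; case/mxvec_indexP => i j; case/mxvec_indexP => k l;
  under eq_fun do rewrite !mxE /= mxvecE vec_mx_delta.
  by apply: mxdiffM => //; exact: mxdiff_cst.
apply: mxdiffM; first exact: mxdiff_cst.
exact: mxdiff_tr.
Qed.

Lemma mxdiff_lyapunov_sol n (F S : V -> 'M[R]_n) :
  mxdiff F -> mxdiff S -> lyapunov_mx (F x) \in unitmx ->
  mxdiff (fun y => lyapunov_sol (F y) (S y)).
Proof.
move=> dF dS uF i j; under eq_fun do rewrite mxE.
apply: mxdiffM; last by apply: mxdiff_inv => //; exact: mxdiff_lyapunov_mx.
apply: mxdiffN => r; rewrite (ord1 r); case/mxvec_indexP => k l.
by under eq_fun do rewrite mxvecE; exact: dS.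
Qed.

End EntrywiseDifferentiability.

(** * Directional derivative of a finite maximum *)

Section Finmax.
Context {R : realType} {I : finType}.
Implicit Types (S : {set I}) (F G : I -> R).

Lemma finmax_ge S F k : k \in S -> F k <= finmax S F.
Proof.
move=> kS; rewrite /finmax; case: pickP => [k0 _|/(_ k)]; last by rewrite kS.
exact: le_bigmax_cond.
Qed.

Lemma finmax_eq S F k : k \in S -> exists2 j, j \in S & finmax S F = F j.
Proof.
move=> kS; rewrite /finmax; case: pickP => [k0 k0S|/(_ k)]; last by rewrite kS.
elim/big_rec: _ => [|i y iS [j jS ->]]; first by exists k0.
by rewrite maxEle; case: ifP => _; [exists j|exists i].
Qed.

Lemma finmax_unique S F k M : k \in S -> (forall j, j \in S -> F j <= M) ->
  (exists2 j, j \in S & M = F j) -> finmax S F = M.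
Proof.
move=> kS FM [j jS ME]; apply/eqP; rewrite eq_le {2}ME finmax_ge // andbT.
by have [i iS ->] := finmax_eq F kS; exact: FM.
Qed.

Lemma finmax_set1 F k : finmax [set k]%SET F = F k.
Proof.
apply: (finmax_unique (set11 k)) => [j|]; first by rewrite inE => /eqP ->.
by exists k; rewrite ?set11.
Qed.

(** Evaluating at a maximiser of either function bounds the difference from one side: the maximum is
    1-Lipschitz for the sup norm. *)
Lemma finmax_dist_le S F G e k : k \in S ->
  (forall j, j \in S -> `|F j - G j| <= e) -> `|finmax S F - finmax S G| <= e.
Proof.
move=> kS FG; rewrite ler_distl.
have [i iS Fi] := finmax_eq F kS; have [j jS Gj] := finmax_eq G kS.
have := FG _ jS; have := FG _ iS; rewrite !ler_distl => /andP[_ Fie] /andP[Fje _].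
rewrite {1}Gj (le_trans Fje) ?finmax_ge //= Fi (le_trans Fie) // lerD2r.
exact: finmax_ge.
Qed.

Lemma cvg_finmax (T : Type) (H : set_system T) {FH : Filter H} S (u : I -> T -> R)
    (l : I -> R) k : k \in S -> (forall j, j \in S -> u j t @[t --> H] --> l j) ->
  finmax S (u ^~ t) @[t --> H] --> finmax S l.
Proof.
move=> kS ul; apply/cvgrPdist_le => e e0.
have : \forall t \near H, forall j, j \in S -> `|l j - u j t| <= e.
  apply: filter_forall => j; case: (boolP (j \in S)) => jS; last exact: nearW.
  by have /cvgrPdist_le/(_ _ e0) := ul j jS; apply: filterS.
by apply: filterS => t ut; exact: finmax_dist_le kS ut.
Qed.

Variables (T : topologicalType) (f : I -> T -> R) (p : T).
Let g q := finmax [set: I]%SET (f ^~ q).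
Let S := [set k | f k p == g p]%SET.

(** A function outside [S] lies strictly below the maximum at [p]; by continuity it stays below
    [f k] nearby, and there are finitely many such functions. *)
Lemma near_finmax_argmax k : k \in S -> (forall j, {for p, continuous (f j)}) ->
  \forall q \near p, g q = finmax S (f ^~ q).
Proof.
move=> kS fc.
have : \forall q \near p, forall j, j \notin S -> f j q < f k q.
  apply: filter_forall => j; case: (boolP (j \in S)) => jS; first exact: nearW.
  have jk : f j p < f k p.
    move: kS jS; rewrite !inE => /eqP -> jp.
    by rewrite lt_neqAle jp finmax_ge.
  have : \forall q \near p, 0 < f k q - f j q.
    apply: (@cvgr_gt _ _ _ _ _ (f k p - f j p)); last by rewrite subr_gt0.
    by apply: cvgB; exact: fc.
  by apply: filterS => q; rewrite subr_gt0.
have kT : k \in [set: I]%SET by rewrite inE.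
apply: filterS => q fq; apply: (finmax_unique kT) => [j _|].
  case: (boolP (j \in S)) => [|/fq /ltW] jS; first exact: finmax_ge.
  by apply: le_trans jS _; exact: finmax_ge.
by have [j _ ->] := finmax_eq (f ^~ q) kS; exists j; rewrite ?inE.
Qed.

End Finmax.

(** * One-sided difference quotients along a ray *)

Section DirectionalDerivative.
Context {R : realType} {n : nat}.
Implicit Types (g : 'cV[R]_n -> R) (p v : 'cV[R]_n).

Lemma cvg_ray p v : p + t *: v @[t --> (0 : R)^'+] --> p.
Proof.
apply: cvg_at_right_filter; rewrite -[X in _ --> X]addr0 -(scale0r v).
apply: cvgD; first exact: cvg_cst.
exact: (@scalel_continuous _ _ v 0).
Qed.

(** Agreement with [phi] is asked only at small [t > 0] and at [t = 0], so a two-sided derivative of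
    [phi] yields the one-sided derivative of [g] even at a kink. *)
Lemma dirquot_derive g (phi : R -> R) p v l : is_derive (0 : R) 1 phi l ->
  (\forall t \near (0 : R)^'+, g (p + t *: v) = phi t) -> g p = phi 0 ->
  dirquot g p v t @[t --> 0^'+] --> l.
Proof.
move=> [dphi <-] gphi gp.
have : h^-1 *: ((phi \o shift 0) (h *: 1) - phi 0) @[h --> (0 : R)^'+] --> 'D_1 phi 0.
  by apply: cvg_dnbhs_at_right; exact: dphi.
apply: cvg_trans; apply: near_eq_cvg; apply: filterS gphi => t gt.
rewrite /dirquot gt gp /= addr0 mulrC; congr (_ * (phi _ - _)).
by rewrite /GRing.scale /= mulr1.
Qed.

Lemma dirquot_differentiable g p v : differentiable g p ->
  dirquot g p v t @[t --> 0^'+] --> 'd g p v.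
Proof.
move=> dg; rewrite -deriveE //.
have : h^-1 *: ((g \o shift p) (h *: v) - g p) @[h --> (0 : R)^'+] --> 'D_v g p.
  by apply: cvg_dnbhs_at_right; exact: diff_derivable.
apply: cvg_trans; apply: near_eq_cvg; apply: nearW => t.
by rewrite /dirquot /= [p + _]addrC mulrC.
Qed.

Lemma gradient_mul g p v : differentiable g p -> (gradient g p *m v) 0 0 = 'd g p v.
Proof.
move=> dg; rewrite mxE.
have {2}-> : v = \sum_j v j 0 *: (delta_mx j 0 : 'cV[R]_n).
  rewrite {1}(matrix_sum_delta v); apply: eq_bigr => i _.
  by rewrite big_ord1.
rewrite linear_sum; apply: eq_bigr => j _.
by rewrite linearZ /= mxE deriveE // mulrC.
Qed.

Lemma cvg_dirderiv g p v l : dirquot g p v t @[t --> 0^'+] --> l ->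
  dirderivable g p v /\ dirderiv g p v = l.
Proof. by move=> gl; split; [apply: cvgP gl|apply: cvg_lim gl]. Qed.

(** All [f j] with [j] in [S] share the value [g p]; subtracting it and dividing by [t > 0]
    preserves order, so maximum and difference quotient commute. *)
Lemma dirquot_finmax (I : finType) (f : I -> 'cV[R]_n -> R) p v (l : I -> R)
    (g := fun q => finmax [set: I]%SET (f ^~ q)) (S := [set k | f k p == g p]%SET) k :
  k \in S -> (forall j, {for p, continuous (f j)}) ->
  (forall j, j \in S -> dirquot (f j) p v t @[t --> 0^'+] --> l j) ->
  dirquot g p v t @[t --> 0^'+] --> finmax S l.
Proof.
move=> kS fc fl.
have : finmax S (fun j => dirquot (f j) p v t) @[t --> (0 : R)^'+] --> finmax S l.
  exact: cvg_finmax kS fl.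
apply: cvg_trans; apply: near_eq_cvg.
have gS : \forall t \near (0 : R)^'+, g (p + t *: v) = finmax S (f ^~ (p + t *: v)).
  exact: cvg_ray (near_finmax_argmax kS fc).
near=> t.
have t0 : 0 < t by near: t; exact: nbhs_right_gt.
have fE j : j \in S -> dirquot (f j) p v t = (f j (p + t *: v) - g p) / t.
  by rewrite inE => /eqP; rewrite /dirquot => ->.
have gE : dirquot g p v t = (finmax S (f ^~ (p + t *: v)) - g p) / t.
  by rewrite /dirquot; congr ((_ - _) / _); near: t.
rewrite gE; apply: (finmax_unique kS) => [j jS|].
  by rewrite fE // ler_pM2r ?invr_gt0 // lerD2r finmax_ge.
have [j jS ->] := finmax_eq (f ^~ (p + t *: v)) kS.
by exists j => //; rewrite fE.
Unshelve. all: by end_near. Qed.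

End DirectionalDerivative.

(** * Derivatives of the line functions *)

Section Lines.
Context {R : realType} (N : network R).
Local Notation s := (ns N).
Local Notation nV := (ns N + nd N).+1.
Implicit Types (p v : 'cV[R]_s) (k : 'I_(nE N)).

Lemma flow_ray k p v t :
  flow k (p + t *: v) = flow k p + t * (row k (flowA N) *m v) 0 0.
Proof.
by rewrite /flow mulmxDr -scalemxAr -row_mul !mxE addrAC.
Qed.

Lemma differentiable_flow k p : differentiable (@flow R N k) p.
Proof.
have dA : mxdiff p (fun q : 'cV[R]_s => flowA N *m q + flowb N).
  apply: mxdiffD; last exact: mxdiff_cst.
  apply: mxdiffM; first exact: mxdiff_cst.
  by move=> i j; exact: differentiable_coord.
exact: dA.
Qed.

Lemma near_flow_lt1 p : (forall k, `|flow k p| < 1) ->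
  \forall q \near p, forall k : 'I_(nE N), `|flow k q| < 1.
Proof.
move=> fl.
apply: (@filter_forall _ 'I_(nE N) (fun k q => `|flow k q| < 1) _
  (nbhs_filter p)) => k.
have fc : {for p, continuous (fun q => `|flow k q|)}.
  apply: continuous_comp; last exact: norm_continuous.
  exact: differentiable_continuous (differentiable_flow k p).
exact: cvgr_lt fc _ (fl k).
Qed.

Lemma mxdiff_Wp p : (forall k : 'I_(nE N), `|flow k p| < 1) -> mxdiff p (@Wp R N).
Proof.
move=> fl k l; under eq_fun do rewrite Wp_diag !mxE.
have [->|_] := eqVneq k l; last exact: differentiable_cst.
rewrite /=; under eq_fun do rewrite mulr1n.
apply: differentiableM; first exact: differentiable_cst.
apply: (differentiable_comp_derive (is_derive_cos _)).
apply: (differentiable_comp_derive (is_derive1_asin _)); first by rewrite -ltr_norml.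
exact: differentiable_flow.
Qed.

Lemma mxdiff_Jd p (V : 'M[R]_nV) : (forall k : 'I_(nE N), `|flow k p| < 1) ->
  mxdiff p (fun q => Jd q V).
Proof.
move=> fl; apply: mxdiff_col_mx; first exact: mxdiff_cst.
apply: mxdiff_row_mx; last exact: mxdiff_cst.
apply: mxdiffN => i j; under eq_fun do rewrite mxE.
suff dmodal : mxdiff p (fun q => modal q V) by exact: dmodal.
do 3![apply: mxdiffM; last exact: mxdiff_cst].
apply: mxdiffM; first exact: mxdiff_cst.
exact: mxdiff_Wp.
Qed.

(* With the frame frozen at p, sigma is given near p by a formula that is
   differentiable even though U need not be. *)
Lemma differentiable_sigma (U : 'cV[R]_s -> 'M[R]_nV) p k :
  (forall l : 'I_(nE N), `|flow l p| < 1) ->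
  (\forall q \near p, modal_frame q (U q)) ->
  hurwitz (Jd p (U p)) -> 0 < sigma U k p -> differentiable (sigma U k) p.
Proof.
move=> fl Uframe Jh sigma_gt0.
pose V := U p; have Vf := nbhs_singleton Uframe; have [VV _ _] := Vf.
have [c V0] := modal_frame_col0 fl Vf.
have dJ := mxdiff_Jd V fl.
have uJ := hurwitz_lyapunov_unit Jh.
pose h q := (Cd V *m lyapunov_sol (Jd q V) (Kd V *m (Kd V)^T) *m (Cd V)^T) k k.
have sE : \forall q \near p, sigma U k q = Num.sqrt (h q).
  near=> q; apply: (sigma_fixed_frame _ _ _ VV V0).
  - by near: q; exact: near_flow_lt1.
  - by near: q.
  - near: q; apply: (near_unitmx (F := fun q => lyapunov_mx (Jd q V))) => //.
    exact: mxdiff_lyapunov_mx.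
apply: (near_eq_differentiable sE).
(* The square root is differentiable only at positive arguments; positivity of [sigma] at [p]
   provides this. *)
have h_gt0 : 0 < h p by move: sigma_gt0; rewrite (nbhs_singleton sE) sqrtr_gt0.
apply: (differentiable_comp_derive (is_derive1_sqrt h_gt0)).
have dh : mxdiff p (fun q =>
    Cd V *m lyapunov_sol (Jd q V) (Kd V *m (Kd V)^T) *m (Cd V)^T).
  apply: mxdiffM; last exact: mxdiff_cst.
  apply: mxdiffM; first exact: mxdiff_cst.
  by apply: mxdiff_lyapunov_sol => //; exact: mxdiff_cst.
exact: dh.
Unshelve. all: by end_near. Qed.

Lemma continuous_f_as k p : `|flow k p| < 1 -> {for p, continuous (@f_as R N k)}.
Proof.
move=> fl; apply: (@continuous_comp _ _ _ (fun q => `|flow k q|) asin).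
  apply: continuous_comp; last exact: norm_continuous.
  exact: differentiable_continuous (differentiable_flow k p).
by apply: continuous_asin; rewrite fl (lt_le_trans _ (normr_ge0 _)) // ltrN10.
Qed.

(** A nonzero flow keeps its sign near [p], so there the absolute value is multiplication by the
    constant sign [e]. *)
Lemma differentiable_f_as k p : `|flow k p| < 1 -> flow k p != 0 ->
  differentiable (@f_as R N k) p.
Proof.
move=> fl f0; pose e := Num.sg (flow k p).
have fc := differentiable_continuous (differentiable_flow k p).
apply: (@near_eq_differentiable _ _ _ _ _ (fun q => asin (e * flow k q))).
  rewrite /f_as; move: f0; rewrite neq_lt => /orP[f0|f0].
    near=> q; rewrite /e ltr0_sg // mulN1r ltr0_norm //; near: q.
    exact: cvgr_lt fc _ f0.
  near=> q; rewrite /e gtr0_sg // mul1r gtr0_norm //; near: q.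
  exact: cvgr_gt fc _ f0.
have ef : -1 < e * flow k p < 1 
  by rewrite -normrEsg fl (lt_le_trans _ (normr_ge0 _)) // ltrN10.
apply: (@differentiable_comp_derive _ _ _ asin (fun q => e * flow k q) _
  (is_derive1_asin ef)).
apply: differentiableM; first exact: differentiable_cst.
exact: differentiable_flow.
Unshelve. all: by end_near. Qed.

(** The number [e] is the sign of the flow on the ray for small [t > 0]. Leaving it as a parameter
    treats positive, negative and zero flow at once. *)
Lemma dirquot_f_as k p v e (a := (row k (flowA N) *m v) 0 0) :
  `|flow k p| < 1 -> e ^+ 2 = 1 -> `|flow k p| = e * flow k p ->
  (\forall t \near (0 : R)^'+, `|flow k p + t * a| = e * (flow k p + t * a)) ->
  dirquot (@f_as R N k) p v t @[t --> 0^'+] -->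
    (Num.sqrt (1 - flow k p ^+ 2))^-1 * (e * a).
Proof.
move=> fl e2 ef eft.
pose phi t := asin (e * (flow k p + t * a)).
apply: (@dirquot_derive _ _ _ phi); last 2 first.
- by apply: filterS eft => t ft; rewrite /f_as /phi flow_ray ft.
- by rewrite /f_as /phi mul0r addr0 ef.
pose psi t := e * (flow k p + t * a).
have dpsi : is_derive (0 : R) 1 psi (e * a).
  have affine (b c : R) : is_derive (0 : R) 1 (cst b + c *: id) c.
    have dc := is_deriveD (is_derive_cst b (0 : R) 1)
      (is_deriveZ c (is_derive_id (0 : R) 1)).
    by apply: (is_derive_eq dc); rewrite add0r [LHS]mulr1.
  rewrite (_ : psi = cst (e * flow k p) + (e * a) *: id); first exact: affine.
  by apply/funext => t; rewrite /psi !fctE /= mulrDr mulrCA mulrC [t * _]mulrC.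
have psi0 : psi 0 = e * flow k p by rewrite /psi mul0r addr0.
have psi1 : -1 < psi 0 < 1.
  by rewrite psi0 -ef fl (lt_le_trans _ (normr_ge0 _)) // ltrN10.
have := is_derive1_comp (is_derive1_asin psi1) dpsi.
by rewrite psi0 exprMn e2 mul1r.
Qed.

End Lines.

(** * Derivatives of a line function according to the sign of the flow *)

Section LineDerivatives.
Context {R : realType} (N : network R).
Variables (U : 'cV[R]_(ns N) -> 'M[R]_((ns N + nd N).+1)).
Variables (p v : 'cV[R]_(ns N)) (k : 'I_(nE N)).
Hypotheses (fl : `|flow k p| < 1) (dsigma : differentiable (sigma U k) p).
Local Notation a := ((row k (flowA N) *m v) 0 0).
Local Notation dsig := ((gradient (sigma U k) p *m v) 0 0).

Lemma dirquot_f_line l : dirquot (@f_as R N k) p v t @[t --> 0^'+] --> l ->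
  dirquot (f_line U k) p v t @[t --> 0^'+] --> l + risk N * dsig.
Proof.
move=> fas; rewrite gradient_mul //.
have -> : dirquot (f_line U k) p v =
    (fun t => dirquot (@f_as R N k) p v t + risk N * dirquot (sigma U k) p v t).
  apply/funext => t; rewrite /dirquot /f_line mulrA -mulrDl mulrBr.
  by congr (_ / _); rewrite addrACA opprD.
apply: cvgD => //; apply: cvgM; first exact: cvg_cst.
exact: dirquot_differentiable.
Qed.

Lemma dirquot_f_as_gt0 : 0 < flow k p -> dirquot (@f_as R N k) p v t @[t --> 0^'+] -->
  (Num.sqrt (1 - flow k p ^+ 2))^-1 * a.
Proof.
move=> f0; rewrite -[X in _ * X]mul1r; apply: dirquot_f_as => //.
- by rewrite expr1n.
- by rewrite mul1r gtr0_norm.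
have fc := differentiable_continuous (differentiable_flow k p).
have : \forall t \near (0 : R)^'+, 0 < flow k (p + t *: v).
  exact: (@cvg_ray _ _ p v _ (cvgr_gt _ fc _ f0)).
apply: filterS => t /=.
by rewrite flow_ray mul1r => /gtr0_norm.
Qed.

Lemma dirquot_f_as_lt0 : flow k p < 0 -> dirquot (@f_as R N k) p v t @[t --> 0^'+] -->
  - (Num.sqrt (1 - flow k p ^+ 2))^-1 * a.
Proof.
move=> f0; rewrite mulNr -mulrN -mulN1r; apply: dirquot_f_as => //.
- by rewrite sqrrN expr1n.
- by rewrite mulN1r ltr0_norm.
have fc := differentiable_continuous (differentiable_flow k p).
have : \forall t \near (0 : R)^'+, flow k (p + t *: v) < 0.
  exact: (@cvg_ray _ _ p v _ (cvgr_lt _ fc _ f0)).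
apply: filterS => t /=.
by rewrite flow_ray mulN1r => /ltr0_norm.
Qed.

Lemma dirquot_f_as_eq0 : flow k p = 0 ->
  dirquot (@f_as R N k) p v t @[t --> 0^'+] --> `|a|.
Proof.
move=> f0; have := fun e => @dirquot_f_as R N k p v e fl.
rewrite f0 expr0n subr0 sqrtr1 invr1 /=; move: ((row k _ *m v) 0 0) => x dfas.
(* From zero flow, the sign along the ray is that of the slope [x]. This form of the sign is never
   0, so its square is 1 even when [x = 0]. *)
have := dfas ((-1) ^+ (x < 0)%R); rewrite mul1r -normrEsign; apply.
- exact: sqrr_sign.
- by rewrite normr0 mulr0.
near=> t; rewrite add0r normrM gtr0_norm; first by rewrite mulrCA -normrEsign.
by near: t; exact: nbhs_right_gt.
Unshelve. all: by end_near. Qed.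

Lemma f_line_dirderiv :
  [/\ dirderivable (f_line U k) p v,
      flow k p != 0 -> dirderiv (f_line U k) p v =
        ((gradient (@f_as R N k) p + risk N *: gradient (sigma U k) p) *m v) 0 0,
      0 < flow k p -> dirderiv (f_line U k) p v =
        (((Num.sqrt (1 - flow k p ^+ 2))^-1 *: row k (flowA N)
           + risk N *: gradient (sigma U k) p) *m v) 0 0,
      flow k p < 0 -> dirderiv (f_line U k) p v =
        ((- (Num.sqrt (1 - flow k p ^+ 2))^-1 *: row k (flowA N)
           + risk N *: gradient (sigma U k) p) *m v) 0 0
    & flow k p = 0 -> dirderiv (f_line U k) p v = `|a| + risk N * dsig].
Proof.
have mulE c (A B : 'rV[R]_(ns N)) :
    ((c *: A + risk N *: B) *m v) 0 0 = c * (A *m v) 0 0 + risk N * (B *m v) 0 0.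
  by rewrite mulmxDl -!scalemxAl !mxE.
split.
- have [f0|f0|f0] := ltgtP (flow k p) 0.
  + by have [] := cvg_dirderiv (dirquot_f_line (dirquot_f_as_lt0 f0)).
  + by have [] := cvg_dirderiv (dirquot_f_line (dirquot_f_as_gt0 f0)).
  + by have [] := cvg_dirderiv (dirquot_f_line (dirquot_f_as_eq0 f0)).
(* Away from zero flow the arcsin term is differentiable, so its quotient tends to gradient times
   [v]. *)
- move=> f0; have df := differentiable_f_as fl f0.
  have [_ ->] := cvg_dirderiv (dirquot_f_line (dirquot_differentiable (v := v) df)).
  by rewrite -[gradient (@f_as R N k) p]scale1r mulE mul1r (gradient_mul v df).
- move=> f0; rewrite mulE.
  by have [_ ->] := cvg_dirderiv (dirquot_f_line (dirquot_f_as_gt0 f0)).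
- move=> f0; rewrite mulE.
  by have [_ ->] := cvg_dirderiv (dirquot_f_line (dirquot_f_as_lt0 f0)).
- by move=> f0; have [_ ->] := cvg_dirderiv (dirquot_f_line (dirquot_f_as_eq0 f0)).
Qed.

End LineDerivatives.

(** * Cases (a), (b) and (c) for the maximum over the lines *)

Theorem proposition4p7 (R : realType) (N : network R)
  (* an open neighborhood of P^+ on which the frames U(p) are chosen *)
  (O : set 'cV[R]_(ns N)) (U : 'cV[R]_(ns N) -> 'M[R]_((ns N + nd N).+1))
  (O_open : open O) (P_sub_O : Pplus N `<=` O)
  (U_frame : forall p, O p -> modal_frame p (U p))
  (flow_lt1 : forall p, Pplus N p -> forall k, `|flow k p| < 1)
  (J_hurwitz : forall p, Pplus N p -> hurwitz (Jd p (U p)))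
  (sigma_gt0 : forall p, Pplus N p -> forall k, 0 < sigma U k p)
  (p v : 'cV[R]_(ns N)) (p_in : Pplus N p) (pv_in : Pplus N (p + v)) :
  (* (a) *)
  (forall k : 'I_(nE N), Imax U p = [set k]%SET -> flow k p != 0 ->
    [/\ dirderivable (f_obj U) p v /\ dirderivable (f_line U k) p v,
        [/\ differentiable (f_obj U) p, differentiable (@f_as R N k) p
          & differentiable (sigma U k) p],
        [/\ dirderiv (f_obj U) p v = dirderiv (f_line U k) p v,
            dirderiv (f_line U k) p v = (gradient (f_obj U) p *m v) 0 0
          & (gradient (f_obj U) p *m v) 0 0 =
            ((gradient (@f_as R N k) p + risk N *: gradient (sigma U k) p)
               *m v) 0 0],
        0 < flow k p ->
          dirderiv (f_obj U) p v =
          (((Num.sqrt (1 - flow k p ^+ 2))^-1 *: row k (flowA N)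
              + risk N *: gradient (sigma U k) p) *m v) 0 0
      & flow k p < 0 ->
          dirderiv (f_obj U) p v =
          ((- (Num.sqrt (1 - flow k p ^+ 2))^-1 *: row k (flowA N)
              + risk N *: gradient (sigma U k) p) *m v) 0 0])
  /\
  (* (b) *)
  (forall k : 'I_(nE N), Imax U p = [set k]%SET -> flow k p = 0 ->
    [/\ dirderivable (f_obj U) p v /\ dirderivable (f_line U k) p v,
        differentiable (sigma U k) p,
        dirderiv (f_obj U) p v = dirderiv (f_line U k) p v
      & dirderiv (f_line U k) p v =
          `|(row k (flowA N) *m v) 0 0|
            + risk N * (gradient (sigma U k) p *m v) 0 0])
  /\
  (* (c) *)
  ((1 < #|Imax U p|)%N ->
    [/\ dirderivable (f_obj U) p v,
        dirderiv (f_obj U) p v =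
          finmax (Imax U p) (fun k => dirderiv (f_line U k) p v)
      & forall k, k \in Imax U p ->
        [/\ dirderivable (f_line U k) p v,
            differentiable (sigma U k) p,
            flow k p != 0 ->
              differentiable (@f_as R N k) p /\
              dirderiv (f_line U k) p v =
              ((gradient (@f_as R N k) p + risk N *: gradient (sigma U k) p)
                 *m v) 0 0,
            (0 < flow k p ->
              dirderiv (f_line U k) p v =
              (((Num.sqrt (1 - flow k p ^+ 2))^-1 *: row k (flowA N)
                  + risk N *: gradient (sigma U k) p) *m v) 0 0) /\
            (flow k p < 0 ->
              dirderiv (f_line U k) p v =
              ((- (Num.sqrt (1 - flow k p ^+ 2))^-1 *: row k (flowA N)
                  + risk N *: gradient (sigma U k) p) *m v) 0 0)
          & flow k p = 0 ->
              dirderiv (f_line U k) p v =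
              `|(row k (flowA N) *m v) 0 0|
                + risk N * (gradient (sigma U k) p *m v) 0 0]]).
Proof.
have fl := flow_lt1 _ p_in.
have ds k : differentiable (sigma U k) p.
  apply: differentiable_sigma => //; [|exact: J_hurwitz|exact: sigma_gt0].
  (* [O] is a full neighborhood of [p], even when [p] lies on the boundary of [P^+]. *)
  by have := open_nbhs_nbhs (conj O_open (P_sub_O _ p_in)); apply: filterS.
have fc k : {for p, continuous (f_line U k)}.
  have fac := continuous_f_as (fl k); have sc := differentiable_continuous (ds k).
  by apply: cvgD fac _; apply: cvgM sc; exact: cvg_cst.
have fline k := f_line_dirderiv v (fl k) (ds k).
(* This limit serves all three cases; for a singleton [Imax] the maximum collapses to one term. *)
have dobj k : k \in Imax U p -> dirquot (f_obj U) p v t @[t --> 0^'+] -->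
    finmax (Imax U p) (fun j => dirderiv (f_line U j) p v).
  move=> kI; apply: (dirquot_finmax (f := f_line U) kI fc) => j _.
  by have [] := fline j.
split; [|split].
- move=> k Ik f0; have kI : k \in Imax U p by rewrite Ik set11.
  have [fo_ex foE] := cvg_dirderiv (dobj k kI).
  rewrite Ik finmax_set1 in foE.
  have [fk_ex fkE fkE1 fkE2 _] := fline k.
  have dfas := differentiable_f_as (fl k) f0.
  (* With a single maximiser, [f_obj] coincides near [p] with the differentiable [f_line U k]. *)
  have dfobj : differentiable (f_obj U) p.
    apply: (near_eq_differentiable (g := f_line U k)).
      have := near_finmax_argmax (f := f_line U) kI fc; apply: filterS => q.
      by rewrite -/(Imax U p) Ik finmax_set1.
    by apply: differentiableD => //; apply: differentiableM.
  have gE : (gradient (f_obj U) p *m v) 0 0 = dirderiv (f_obj U) p v.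
    rewrite gradient_mul //.
    by have [_ ->] := cvg_dirderiv (dirquot_differentiable (v := v) dfobj).
  split=> //.
  + by rewrite gE foE; split=> //; rewrite fkE.
  + by rewrite foE => /fkE1.
  + by rewrite foE => /fkE2.
- move=> k Ik f0; have kI : k \in Imax U p by rewrite Ik set11.
  have [fo_ex foE] := cvg_dirderiv (dobj k kI).
  rewrite Ik finmax_set1 in foE.
  by have [fk_ex _ _ _ fkE] := fline k; split=> //; exact: fkE.
- move=> I2; have /card_gt0P[k kI] : (0 < #|Imax U p|)%N by exact: ltnW.
  have [fo_ex foE] := cvg_dirderiv (dobj k kI).
  split=> // j _; have [fk_ex fkE fkE1 fkE2 fkE0] := fline j.
  split=> // f0; split; [exact: differentiable_f_as|exact: fkE].
Qed.
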